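(* Let $\Gamma$ be a countable group and let $F\subseteq\Gamma$ be a finite set. Set $G = G(\mathrm{Free}(2^{\Gamma}),F)$. Then $\chi^\ast_{\mathrm{B}}(G)\leq\chi_\beta(G)$.
   Context: All graphs are undirected and simple. A graph $G$ is Borel if $V(G)$ is a standard Borel space and $E(G)$ is a Borel subset of $V(G)\times V(G)$. A set $I \subseteq V(G)$ is $G$-independent if no two vertices in $I$ are adjacent in $G$. For $k \geq 1$, the Borel $k$-fold chromatic number $\chi^k_{\mathrm{B}}(G)$ is the least $\ell \in \mathbb{N}$ such that there are Borel $G$-independent sets $I_1,\ldots,I_\ell$ (not necessarily distinct) that cover every vertex of $G$ at least $k$ times, i.e., every $x \in V(G)$ belongs to $I_i$ for at least $k$ indices $i$ ($\chi^k_{\mathrm{B}}(G) = \infty$ if no such $\ell$ exists). The Borel fractional chromatic number is $\chi^\ast_{\mathrm{B}}(G) = \inf_{k\geq 1} \chi^k_{\mathrm{B}}(G)/k$. For a Borel measure $\mu$ on $V(G)$, the $\mu$-measurable chromatic number $\chi_\mu(G)$ is the least $\ell\in\mathbb{N}$ such that there exist $\mu$-measurable $G$-independent sets $I_1,\ldots,I_\ell$ whose union is $V(G)$. Given a Borel action $\Gamma \curvearrowright X$ of a countable group on a standard Borel space and a finite set $F \subseteq \Gamma$, the Schreier graph $G(X,F)$ has vertex set $X$, with two distinct points $x,y\in X$ adjacent iff $y = \sigma\cdot x$ for some $\sigma \in F\cup F^{-1}$. The Bernoulli shift $\Gamma \curvearrowright 2^\Gamma$ (where $2=\{0,1\}$)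 is given by $(\gamma\cdot x)(\delta) = x(\delta\gamma)$ for $x\colon\Gamma\to 2$ and $\gamma,\delta\in\Gamma$. $\mathrm{Free}(2^\Gamma)$ is the set of all $x\in 2^\Gamma$ with trivial stabilizer under the shift, with the induced action. $\beta$ is the product probability measure on $2^\Gamma$ of copies of the uniform probability measure on $\{0,1\}$, restricted to $\mathrm{Free}(2^\Gamma)$ where appropriate. *)

(* Defs.v *)
From HB Require Import structures.
From mathcomp Require Import all_boot all_order all_algebra.
From mathcomp Require Import all_classical all_reals all_analysis.
From mathcomp Require Import measurable_realfun.

Set Implicit Arguments.
Unset Strict Implicit.
Unset Printing Implicit Defensive.

Import Order.TTheory GRing.Theory Num.Theory.

Local Open Scope classical_set_scope.
Local Open Scope ring_scope.
Local Open Scope ereal_scope.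

Definition Borel (T : ptopologicalType) := g_sigma_algebraType (@open T).

(** The vertex set is a subset of an ambient type [T]. When it is a Borel subset
    of a standard Borel space [T], it is itself standard Borel, and its Borel
    subsets are the measurable sets of [T] that it contains. *)
Record graph (T : Type) := Graph {
  vertices : set T;
  edge : T -> T -> Prop;
  edge_vertices : forall x y, edge x y -> vertices x /\ vertices y;
  edge_irrefl : forall x, ~ edge x x;
  edge_sym : forall x y, edge x y -> edge y x }.

Definition independent (T : Type) (G : graph T) (I : set T) :=
  I `<=` vertices G /\ forall x y, I x -> I y -> ~ edge G x y.

Section chromatic_numbers.
Context d (T : measurableType d) (R : realType).

(** The infimum of a set of natural numbers is its least element, and it is
    [+oo] when that set is empty. *)
Definition borel_kfold_chromatic (G : graph T) (k : nat) : \bar R :=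
  ereal_inf [set l%:R%:E | l in [set l : nat | exists I : 'I_l -> set T,
    (forall i, measurable (I i) /\ independent G (I i)) /\
    (forall x, vertices G x -> (k <= #|[pred i | x \in I i]|)%N)]].

Definition borel_fractional_chromatic (G : graph T) : \bar R :=
  ereal_inf [set borel_kfold_chromatic G k * (k%:R^-1)%:E
            | k in [set k | (1 <= k)%N]].

(** [completed_algebra_gen mu] consists of the unions of a measurable set and a
    [mu]-negligible set, that is, of the [mu]-measurable sets. *)
Definition measure_chromatic (mu : {measure set T -> \bar R}) (G : graph T)
    : \bar R :=
  ereal_inf [set l%:R%:E | l in [set l : nat | exists I : 'I_l -> set T,
    (forall i, completed_algebra_gen mu (I i) /\ independent G (I i)) /\
    \bigcup_i I i = vertices G]].

End chromatic_numbers.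
Arguments borel_kfold_chromatic {d T} R G k.
Arguments borel_fractional_chromatic {d T} R G.

Record group_action (Gamma : groupType) (T : Type) := GroupAction {
  act :> Gamma -> T -> T;
  act1 : forall x, act 1%g x = x;
  actM : forall g h x, act (g * h)%g x = act g (act h x) }.

Section schreier_graph.
Context (Gamma : groupType) (T : Type).
Variables (a : group_action Gamma T) (X : set T) (F : set Gamma).

Definition schreier_edge (x y : T) : Prop :=
  [/\ X x, X y, x <> y &
      exists2 s, (F `|` [set g^-1%g | g in F]) s & y = a s x].

Lemma schreier_edge_vertices x y : schreier_edge x y -> X x /\ X y.
Proof. by case. Qed.

Lemma schreier_edge_irrefl x : ~ schreier_edge x x.
Proof. by case. Qed.

Lemma schreier_edge_sym x y : schreier_edge x y -> schreier_edge y x.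
Proof.
case=> Xx Xy xy [s Fs ys]; split => //; first exact: nesym.
exists s^-1%g; last by rewrite ys -actM mulVg act1.
by case: Fs => [Fs|[g Fg <-]]; [right; exists s|left; rewrite invgK].
Qed.

(** [X] is meant to be invariant under [a]; this is then the Schreier graph of
    the induced action on [X]. *)
Definition schreier_graph : graph T :=
  Graph schreier_edge_vertices schreier_edge_irrefl schreier_edge_sym.

End schreier_graph.

Section bernoulli.
Variable Gamma : groupType.

Definition shift_space : Type := prod_topology (fun _ : Gamma => bool).

HB.instance Definition _ := Pointed.on shift_space.
HB.instance Definition _ := Nbhs.on shift_space.
HB.instance Definition _ := Topological.on shift_space.

Definition shift_fun (g : Gamma) (x : shift_space) : shift_space :=
  fun delta => x (delta * g)%g.

Lemma shift_fun1 x : shift_fun 1%g x = x.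
Proof. by apply/funext => delta; rewrite /shift_fun mulg1. Qed.

Lemma shift_funM g h x : shift_fun (g * h)%g x = shift_fun g (shift_fun h x).
Proof. by apply/funext => delta; rewrite /shift_fun mulgA. Qed.

Definition bernoulli_shift : group_action Gamma (Borel shift_space) :=
  GroupAction shift_fun1 shift_funM.

Definition Free : set (Borel shift_space) :=
  [set x | forall g, bernoulli_shift g x = x -> g = 1%g].

Lemma Free_invariant g x : Free x -> Free (bernoulli_shift g x).
Proof.
move=> fx h; rewrite -actM => /(congr1 (bernoulli_shift g^-1%g)).
rewrite -!actM mulgA mulVg act1 => /fx.
move=> /(congr1 (fun u => g * u * g^-1)%g).
by rewrite !mulgA mulgV mul1g mulgK mulg1 mulgV.
Qed.

Lemma measurable_Free : countable [set: Gamma] -> measurable Free.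
Proof.
move=> cG; pose D g := [set x : shift_space | exists u, x (u * g)%g != x u].
have oD g : open (D g).
  have -> : D g = \bigcup_u \bigcup_b
      ([set x : shift_space | x (u * g)%g = b] `&` [set x | x u = ~~ b]).
    apply/seteqP; split => [x [u xu]|x [u _ [b _ [/= xb xc]]]].
      exists u => //; exists (x (u * g)%g) => //; split => //=.
      by move: xu; case: (x u); case: (x _).
    by exists u; rewrite xb xc; case: b {xb xc}.
  apply: bigcup_open => u _; apply: bigcup_open => b _.
  have oP v c : open [set x : shift_space | x v = c].
    have pv := iffLR (@continuousP shift_space bool _)
      (@proj_continuous _ (fun _ : Gamma => bool) v).
    exact: (pv [set c] (discrete_open _)).
  by apply: openI; exact: oP.
have -> : Free =
    ~` \bigcup_g (if g == 1%g then set0 else ~` (D g : set (Borel shift_space))).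
  apply/seteqP; split => [x fx [g _]|x nx g gx].
    case: eqP => // g1 /= Dg; apply/g1/fx/funext => u; rewrite /= /shift_fun.
    by apply/eqP/negPn/negP => xu; apply: Dg; exists u.
  apply: contrapT => g1; apply: nx; exists g => //.
  case: eqP => // _ [u /eqP]; apply.
  exact: (congr1 (fun f : shift_space => f u) gx).
apply: measurableC; apply: countable_bigcupT_measurable => // g.
case: eqP => // _; apply: measurableC; apply: sub_sigma_algebra; exact: oD.
Qed.

(** [beta] is the product of copies of the uniform measure on [bool]: its values
    on the cylinders determine it on all Borel sets when [Gamma] is
    countable. *)
Definition is_bernoulli_measure (R : realType)
    (beta : probability (Borel shift_space) R) :=
  forall (s : seq Gamma) (A : Gamma -> set bool), uniq s ->
    beta [set x | forall g, g \in s -> A g (x g)] =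
    \prod_(g <- s) bernoulli_prob 2^-1 (A g).

End bernoulli.

(* Main.v *)
Require Import Defs.
From HB Require Import structures.
From mathcomp Require Import all_boot all_order all_algebra.
From mathcomp Require Import all_classical all_reals all_analysis.
From mathcomp Require Import lra.

(** Let [Gamma] be infinite. If [l] measurable independent sets cover the free
    part, one of them contains a Borel independent set [A] with [beta A] almost
    [1 / l]. Approximating [A] by a set depending on finitely many coordinates
    and removing the points that have a neighbour in it gives a set [U], of
    almost the same measure, that depends only on the coordinates in a finite
    [D] and satisfies [s U `&` U = set0] for [s] in the symmetrized [F] minus
    the identity. Choose a Borel colouring [c] of the free part with finitely
    many colours that is injective on each [D x]. For every map [phi] from
    colours to [bool], the equivariant map [x |-> (g |-> phi (c (g x)))] pulls
    [U] back to a Borel independent set. For a fixed [x] the bits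
    [phi (c (g x))], [g] in [D], are independent and uniform as [phi] varies, so
    [x] lies in exactly the fraction [beta U] of these pullbacks, and the
    fractional chromatic number is at most [1 / beta U]. *)

Set Implicit Arguments.
Unset Strict Implicit.
Unset Printing Implicit Defensive.

Import Order.TTheory GRing.Theory Num.Theory.

Local Open Scope classical_set_scope.
Local Open Scope ring_scope.
Local Open Scope ereal_scope.

(** * Greedy Borel colourings *)

Section discrete_valued.
Context d (T : measurableType d).

(* This is measurability for the discrete sigma-algebra on [C], without the need
   to endow [C] with a measurable structure. *)
Definition discrete_mfun (C : Type) (f : T -> C) :=
  forall B : set C, measurable (f @^-1` B).

Lemma discrete_mfun_comp (C C' : Type) (h : C -> C') (f : T -> C) :
  discrete_mfun f -> discrete_mfun (h \o f).
Proof. move=> mf B. exact: (mf (h @^-1` B)). Qed.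

Lemma discrete_mfun_cst (C : Type) (c : C) :
  discrete_mfun (fun=> c).
Proof.
move=> B; have [Bc|nBc] := pselect (B c).
  by rewrite (_ : _ @^-1` B = setT) //; apply/seteqP; split => x.
by rewrite (_ : _ @^-1` B = set0) //; apply/seteqP; split => x.
Qed.

Lemma discrete_mfun_fiber (C : countType) (f : T -> C) :
  (forall c, measurable (f @^-1` [set c])) -> discrete_mfun f.
Proof.
move=> mf B; have -> : f @^-1` B =
    \bigcup_c (if `[< B c >] then f @^-1` [set c] else set0).
  apply/seteqP; split => [x Bx|x [c _]].
    by exists (f x) => //; rewrite asboolT.
  by case: ifPn => // /asboolP Bc fxc; rewrite /preimage/= fxc.
by apply: countable_bigcupT_measurable => // c; case: ifP.
Qed.

Lemma discrete_mfun_pair (C C' : countType) (f : T -> C) (h : T -> C') :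
  discrete_mfun f -> discrete_mfun h ->
  discrete_mfun (fun x => (f x, h x)).
Proof.
move=> mf mh; apply: discrete_mfun_fiber => -[c c'].
have -> : (fun x => (f x, h x)) @^-1` [set (c, c')] =
    f @^-1` [set c] `&` h @^-1` [set c'].
  by apply/seteqP; split => [x [<- <-]|x [<- <-]].
by apply: measurableI; [exact: mf|exact: mh].
Qed.

Lemma discrete_mfun_map (I : Type) (C : countType) (f : I -> T -> C)
    (s : seq I) :
  (forall i, discrete_mfun (f i)) ->
  discrete_mfun (fun x => [seq f i x | i <- s]).
Proof.
move=> mf; elim: s => [|i s IHs]; first exact: discrete_mfun_cst.
exact: (discrete_mfun_comp (fun p => p.1 :: p.2)
  (discrete_mfun_pair (mf i) IHs)).
Qed.

End discrete_valued.

Lemma discrete_mfun_precomp d (T : measurableType d) d'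
    (T' : measurableType d') (C : Type) (f : T -> C) (s : T' -> T) : measurable_fun setT s -> discrete_mfun f ->
  discrete_mfun (f \o s).
Proof.
move=> ms mf B; rewrite -[X in measurable X]setTI.
exact: (ms measurableT _ (mf B)).
Qed.

(** The least index is Borel: its fibre over [k] is [B k] minus the earlier sets. Points outside
    every [B j] get the default 0, whence the extra piece for [k = 0]. *)
Lemma discrete_mfun_first d (T : measurableType d) (B : nat -> set T) :
  (forall j, measurable (B j)) ->
  exists2 n : T -> nat, discrete_mfun n &
    forall x, (exists j, B j x) -> B (n x) x.
Proof.
move=> mB; pose P x := [pred j | `[< B j x >]].
have Pex x : (exists j, B j x) -> exists j, P x j.
  by case=> j Bj; exists j; apply/asboolP.
exists (fun x => if pselect (exists j, B j x) is left e
                 then ex_minn (Pex x e) else 0%N); last first.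
  by move=> x ex; case: pselect => // e; case: ex_minnP => m /asboolP.
apply: discrete_mfun_fiber => k.
have -> : (fun x => if pselect (exists j, B j x) is left e
                 then ex_minn (Pex x e) else 0%N) @^-1` [set k] =
   (B k `\` \bigcup_(i < k) B i) `|`
   (if k == 0%N then ~` \bigcup_j B j else set0).
  apply/seteqP; split => x /=.
    case: pselect => [e|ne].
      case: ex_minnP => m /asboolP Bm mm <-; left; split => // -[i /= im Bi].
      by move: im; rewrite ltnNge mm//; exact/asboolP.
    by move=> <-; right => -[j _ Bj]; apply: ne; exists j.
  case=> [[Bk nB]|].
    case: pselect => [e|[]]; last by exists k.
    case: ex_minnP => m /asboolP Bm mm.
    apply/eqP; rewrite eqn_leq mm; last exact/asboolP.
    by rewrite leqNgt; apply/negP => mk; apply: nB; exists m.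
  case: eqP => // -> nB; case: pselect => // -[j Bj]; exfalso; apply: nB.
  by exists j.
apply: measurableU.
  by apply: measurableD => //; exact: bigcup_measurable.
by case: eqP => // _; apply/measurableC/bigcup_measurable.
Qed.

(** The minimal excludant. By pigeonhole the first [(size s).+1] numbers cannot all lie in [s], so
    the search succeeds. *)
Definition mex (s : seq nat) := find (fun k => k \notin s) (iota 0 (size s).+1).

Lemma has_mex s : has (fun k => k \notin s) (iota 0 (size s).+1).
Proof.
apply/negPn/negP => /hasPn h.
have sub : {subset iota 0 (size s).+1 <= s}.
  by move=> k ks; apply/negPn/h.
by have := uniq_leq_size (iota_uniq _ _) sub; rewrite size_iota ltnn.
Qed.

Lemma mex_leq s : (mex s <= size s)%N.
Proof. by rewrite -ltnS -[X in (_ < X)%N](size_iota 0) -has_find has_mex. Qed.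

Lemma mex_notin s : mex s \notin s.
Proof.
have := nth_find 0%N (has_mex s); rewrite nth_iota ?add0n//.
by rewrite ltnS mex_leq.
Qed.

Section greedy_coloring.
Context d (T : measurableType d) (I : finType).
Variables (s : I -> T -> T) (X : set T) (n : T -> nat).
Hypotheses (ms : forall i, measurable_fun setT (s i))
  (sX : forall i x, X x -> X (s i x))
  (s_inv : forall i, exists j, forall x, s j (s i x) = x)
  (mn : discrete_mfun n)
  (n_proper : forall i x, X x -> n (s i x) <> n x).

(* Before stage [n x] the point [x] has the provisional colour 0. Avoiding it as
   well is harmless to the neighbours of [x]. *)
Fixpoint greedy (j : nat) (x : T) : nat :=
  if j is j'.+1 then
    if n x == j' then mex [seq greedy j' (s i x) | i <- enum I]
    else greedy j' x
  else 0%N.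

Lemma discrete_mfun_greedy j : discrete_mfun (greedy j).
Proof.
elim: j => [|j IH] /=; first exact: discrete_mfun_cst.
exact: (discrete_mfun_comp
  (fun p => if p.1 == j then mex p.2.1 else p.2.2)
  (discrete_mfun_pair mn (discrete_mfun_pair
    (discrete_mfun_map (enum I)
      (fun i => discrete_mfun_precomp (ms i) IH)) IH))).
Qed.

Lemma greedy_leq j x : (greedy j x <= #|I|)%N.
Proof.
elim: j x => //= j IH x; case: ifP => // _.
by apply: leq_trans (mex_leq _) _; rewrite size_map -cardE.
Qed.

(** The colour of [x] can change only between stage [n x] and the next, so [greedy (n x).+1 x] is
    its final colour. *)
Lemma greedy_stable j x : (n x < j)%N -> greedy j x = greedy (n x).+1 x.
Proof.
elim: j => // j IH; rewrite ltnS leq_eqVlt => /orP[/eqP<-//|nj].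
by rewrite -IH//= ltn_eqF.
Qed.

(** When [x] is recoloured, the colour of [s i x] is already final, and [mex] avoids it. *)
Lemma greedy_proper_lt i x : X x -> (n (s i x) < n x)%N ->
  greedy (n (s i x)).+1 (s i x) <> greedy (n x).+1 x.
Proof.
move=> Xx lt; rewrite [in RHS]/= eqxx -(greedy_stable lt) => e.
have := mex_notin [seq greedy (n x) (s i x) | i <- enum I].
by rewrite -e => /negP; apply; apply/mapP; exists i; rewrite ?mem_enum.
Qed.

Lemma finite_coloring : exists2 c : T -> 'I_#|I|.+1, discrete_mfun c &
  forall i x, X x -> c (s i x) <> c x.
Proof.
exists (fun x => inord (greedy (n x).+1 x)) => [|i x Xx].
  apply: (discrete_mfun_comp inord) => B.
  have -> : (fun x => greedy (n x).+1 x) @^-1` B =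
      \bigcup_j (n @^-1` [set j] `&` greedy j.+1 @^-1` B).
    apply/seteqP; split => [x Bx|x [j _ [/= <-]]//].
    by exists (n x).
  apply: bigcup_measurable => j _; apply: measurableI; first exact: mn.
  exact: discrete_mfun_greedy.
move=> /(congr1 (@nat_of_ord _)); rewrite !inordK ?ltnS ?greedy_leq//.
case: (ltngtP (n (s i x)) (n x)) => [lt|lt|e _]; last exact: n_proper e.
  exact: greedy_proper_lt.
(* Here [s i x] is the later point, and [x] is its neighbour through the inverse index [j]. *)
have [j jK] := s_inv i; have := @greedy_proper_lt j (s i x) (sX i Xx).
by rewrite jK => /(_ lt) h e; apply: h.
Qed.

End greedy_coloring.

(** * Sets depending on finitely many coordinates *)

Section windows.
Variable Gamma : groupType.
Implicit Types (D E : seq Gamma) (U V : set (shift_space Gamma)).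
Local Notation X := (Borel (shift_space Gamma)).

Definition determined D U :=
  forall x y : shift_space Gamma, {in D, x =1 y} -> U x -> U y.

(** The value [false] off [D] is arbitrary: sets determined by [D] do not see it. *)
Definition extend D (v : seq bool) : shift_space Gamma :=
  fun g => nth false v (index g D).

Lemma extend_map D (x : shift_space Gamma) :
  {in D, extend D [seq x g | g <- D] =1 x}.
Proof. by move=> g gD; rewrite /extend (nth_map g) ?nth_index ?index_mem. Qed.

Lemma determined_extend D U (x : shift_space Gamma) : determined D U ->
  U x <-> U (extend D [seq x g | g <- D]).
Proof.
move=> dU; split; apply: dU => g gD; last exact: extend_map.
by rewrite extend_map.
Qed.

Lemma determined0 : determined [::] set0.
Proof. by []. Qed.

Lemma determinedC D U : determined D U -> determined D (~` U).
Proof. by move=> dU x y xy nUx Uy; apply/nUx/(dU y) => // g gD; rewrite xy. Qed.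

Lemma determinedU D E U V : determined D U -> determined E V ->
  determined (D ++ E) (U `|` V).
Proof.
move=> dU dV x y xy [Ux|Vx]; [left; apply: dU Ux|right; apply: dV Vx].
  by move=> g gD; rewrite xy// mem_cat gD.
by move=> g gE; rewrite xy// mem_cat gE orbT.
Qed.

(** The sets of points agreeing with [x] on a finite window form a filter basis. It converges to [x]
    because convergence in the product is tested one coordinate at a time, where a one-element
    window suffices. *)
Lemma open_window (O : set (shift_space Gamma)) (x : shift_space Gamma) :
  open O -> O x -> exists D, forall y, {in D, x =1 y} -> O y.
Proof.
move=> oO Ox.
pose W D := [set y : shift_space Gamma | {in D, x =1 y}].
have FF : Filter (filter_from [set: seq Gamma] W).
  apply: filter_from_filter; first by exists [::].
  move=> D E _ _; exists (D ++ E) => // y xy; split=> g gDE; apply: xy;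
    by rewrite mem_cat gDE ?orbT.
have : filter_from [set: seq Gamma] W --> x.
  apply/cvg_sup => g A.
  have /= -> := @nbhsE (initial_topology (fun f : shift_space Gamma => f g)) x.
  case=> B [[C oC <- Cx]] /filterS; apply; exists [:: g] => // y xy.
  by move: Cx; rewrite /preimage/= xy ?inE.
have nO : nbhs x O by exact: open_nbhs_nbhs.
by move=> /(_ O nO) [D _ WO]; exists D => y /WO.
Qed.

Lemma discrete_mfun_coord (g : Gamma) :
  discrete_mfun (fun x : X => x g).
Proof.
move=> B; apply: sub_sigma_algebra.
have coP := iffLR (@continuousP (shift_space Gamma) bool _)
  (@proj_continuous _ (fun _ : Gamma => bool) g).
exact: (coP B (discrete_open _)).
Qed.

Section coordinatewise.
Context d (T : measurableType d) (f : T -> shift_space Gamma).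
Hypothesis mf : forall g, discrete_mfun (fun t => f t g).

(** Membership of [f t] in [U] depends only on the list of bits of [f t] on [D], which is a
    measurable function of [t] into a countable type. *)
Lemma measurable_preimage_determined D U :
  determined D U -> measurable (f @^-1` U).
Proof.
move=> dU; have -> : f @^-1` U =
    (fun t => [seq f t g | g <- D]) @^-1` (extend D @^-1` U).
  by apply/seteqP; split=> t /=; rewrite -(determined_extend _ dU).
exact: (discrete_mfun_map D mf).
Qed.

End coordinatewise.

Lemma determined_measurable D U : determined D U -> measurable (U : set X).
Proof.
exact: (@measurable_preimage_determined _ X id discrete_mfun_coord D U).
Qed.

Hypothesis cGamma : countable [set: Gamma].

Lemma enumeration : exists e : nat -> Gamma, forall g, exists n, e n = g.
Proof.
have /countable_injP[f finj] := cGamma.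
exists (fun n => xget 1%g [set g | f g = n]) => g; exists (f g).
by case: xgetP => [h _ /= /finj|/(_ g)/= ?//]; apply; rewrite ?inE.
Qed.

Lemma window_mkseq (e : nat -> Gamma) D : (forall g, exists n, e n = g) ->
  exists n, {subset D <= mkseq e n}.
Proof.
move=> eP; elim: D => [|g D [n Dn]]; first by exists 0%N.
have [m <-] := eP g; exists (maxn m.+1 n) => h; rewrite inE => /orP[/eqP->|].
  by apply: map_f; rewrite mem_iota/= add0n leq_max ltnSn.
move=> /Dn /mapP[i]; rewrite mem_iota/= add0n => lt ->; apply: map_f.
by rewrite mem_iota/= add0n leq_max lt orbT.
Qed.

(* The [n]-th piece is the largest set depending only on the first [n]
   coordinates that is contained in [O]. *)
Lemma open_bigcup_determined (O : set (shift_space Gamma)) : open O ->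
  exists (D : nat -> seq Gamma) (U : nat -> set (shift_space Gamma)),
    (forall n, determined (D n) (U n)) /\ O = \bigcup_n U n.
Proof.
move=> oO; have [e eP] := enumeration.
exists (mkseq e), (fun n => [set x : shift_space Gamma |
  forall y : shift_space Gamma, {in mkseq e n, x =1 y} -> O y]).
split=> [n x y xy Ux z yz|].
  by apply: Ux => g gD; rewrite xy// yz.
apply/seteqP; split=> [x Ox|x [n _]]; last exact.
have [D DO] := open_window oO Ox; have [n Dn] := window_mkseq D eP.
by exists n => // y xy; apply: DO => g /Dn/xy.
Qed.

Lemma measurable_coordinatewise d (T : measurableType d) (f : T -> X) :
  (forall g, discrete_mfun (fun t => f t g)) ->
  measurable_fun setT f.
Proof.
move=> mf.
apply: (@measurability _ _ T X setT f (@open (shift_space Gamma))) => //.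
move=> _ [Q oQ <-]; rewrite setTI.
have [D [U [dU ->]]] := open_bigcup_determined oQ.
rewrite preimage_bigcup; apply: bigcup_measurable => n _.
exact: measurable_preimage_determined (dU n).
Qed.

Lemma measurable_shift (g : Gamma) :
  measurable_fun setT (bernoulli_shift Gamma g).
Proof.
by apply: measurable_coordinatewise => h; exact: discrete_mfun_coord.
Qed.

Section approximation.
Context (R : realType) (mu : {measure set X -> \bar R}).
Hypothesis mu_fin : mu setT < +oo.

(** Measurability is part of the predicate so that it is available in the union steps of the
    induction over the sigma-algebra. *)
Definition approximable (A : set X) := measurable A /\
  forall e : R, (0 < e)%R -> exists D U, determined D U /\
    mu ((A `\` U) `|` (U `\` A)) < e%:E.

Lemma determined_approximable D U : determined D U -> approximable U.
Proof.
move=> dU; split; first exact: determined_measurable dU.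
by move=> e e0; exists D, U; rewrite !setDv setU0 measure0 lte_fin.
Qed.

Lemma approximableC A : approximable A -> approximable (~` A).
Proof.
case=> mA aA; split; first exact: measurableC.
move=> e /aA[D [U [dU AU]]]; exists D, (~` U); split; first exact: determinedC.
by rewrite !setDE !setCK setUC (setIC _ A) (setIC _ U) -!setDE.
Qed.

Lemma approximableU A B :
  approximable A -> approximable B -> approximable (A `|` B).
Proof.
case=> mA aA [mB aB]; split; first exact: measurableU.
move=> e e0; have e20 : (0 < e / 2)%R by rewrite divr_gt0.
have [D [U [dU AU]]] := aA _ e20; have [E [V [dV BV]]] := aB _ e20.
exists (D ++ E), (U `|` V); split; first exact: determinedU.
have mU := determined_measurable dU; have mV := determined_measurable dV.
rewrite [e]splitr EFinD; apply: le_lt_trans (lteD AU BV).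
apply: le_trans (measureU2 _ _ _); [|by apply: measurableU; exact: measurableD..].
apply: le_measure; rewrite ?inE.
- by apply: measurableU; apply: measurableD; exact: measurableU.
- by apply: measurableU; apply: measurableU; exact: measurableD.
- move=> x [[[Ax|Bx] /not_orP[nU nV]]|[[Ux|Vx] /not_orP[nA nB]]].
  + by left; left.
  + by right; left.
  + by left; right.
  + by right; right.
Qed.

(** By continuity from below and finiteness of [mu], some finite partial union misses less than
    [e / 2]; approximating that partial union costs the other half. *)
Lemma approximable_bigcup (A : (set X)^nat) :
  (forall n, approximable (A n)) -> approximable (\bigcup_n A n).
Proof.
move=> aA; have mA n : measurable (A n) by case: (aA n).
have mUA : measurable (\bigcup_n A n) by exact: bigcup_measurable.
split=> // e e0; have e20 : (0 < e / 2)%R by rewrite divr_gt0.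
pose B n := \big[setU/set0]_(i < n.+1) A i.
have aB n : approximable (B n).
  rewrite /B; elim/big_rec: _ => [|i C _ aC].
    exact: determined_approximable determined0.
  exact: approximableU.
have UB : \bigcup_n B n = \bigcup_n A n by exact: bigcup_bigsetU_bigcup.
have mB n : measurable (B n) by case: (aB n).
have := @nondecreasing_cvg_mu _ _ _ mu B mB.
have ndB : nondecreasing_seq B.
  by move=> m n mn; exact/subsetPset/subset_bigsetU.
rewrite UB => /(_ mUA ndB) cB.
have fU : mu (\bigcup_n A n) \is a fin_num.
  rewrite ge0_fin_numE//; apply: le_lt_trans mu_fin.
  by apply: le_measure; rewrite ?inE.
have [n Bn] : exists n, mu (\bigcup_n A n) - (e / 2)%:E < mu (B n).
  have lt : mu (\bigcup_n A n) - (e / 2)%:E < mu (\bigcup_n A n).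
    by rewrite lteBlDr// lteDl// lte_fin.
  have : \forall n \near \oo, mu (\bigcup_n A n) - (e / 2)%:E < mu (B n).
    exact: (cB _ (open_ereal_gt' lt)).
  by case=> n _ h; exists n; apply: h => /=.
have [D [U [dU BU]]] := (aB n).2 _ e20.
exists D, U; split=> //; have mU := determined_measurable dU.
have BA : B n `<=` \bigcup_n A n by rewrite -UB; exact: bigcup_sup.
have ABn : mu ((\bigcup_n A n) `\` B n) < (e / 2)%:E.
  rewrite measureD//; last by rewrite ltey_eq fU.
  rewrite (setIidr BA) lteBlDr; last first.
    rewrite ge0_fin_numE//; apply: le_lt_trans mu_fin.
    by apply: le_measure; rewrite ?inE.
  by rewrite addeC -lteBlDr.
rewrite [e]splitr EFinD; apply: le_lt_trans (lteD ABn BU).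
apply: le_trans (measureU2 _ _ _); [|exact: measurableD|
  by apply: measurableU; exact: measurableD].
apply: le_measure; rewrite ?inE.
- by apply: measurableU; exact: measurableD.
- apply: measurableU; first exact: measurableD.
  by apply: measurableU; exact: measurableD.
- move=> x [[Ax nU]|[Ux nA]].
    by have [Bx|nBx] := pselect (B n x); [right; left|left].
  by right; right; split=> // /BA.
Qed.

Lemma measurable_approximable (A : set X) : measurable A -> approximable A.
Proof.
apply: smallest_sub A; first split.
- exact: determined_approximable determined0.
- by move=> A aA; rewrite setTD; exact: approximableC.
- exact: approximable_bigcup.
- move=> O /open_bigcup_determined[D [U [dU ->]]].
  by apply: approximable_bigcup => n; exact: determined_approximable (dU n).
Qed.

End approximation.
End windows.

(** * Borel colourings of the free part *)

Section orbit_coloring.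
Variable Gamma : groupType.
Hypothesis cGamma : countable [set: Gamma].
Local Notation X := (Borel (shift_space Gamma)).
Local Notation shift := (bernoulli_shift Gamma).

Section translation_coloring.
Variables (J : finType) (s : J -> Gamma).
Hypotheses (s_neq1 : forall i, s i != 1%g)
  (s_inv : forall i, exists j, s j = (s i)^-1%g).

(* The sets [B v] of the points [x] whose initial segment is [v] while no
   neighbour of [x] starts with [v] are countably many, Borel, independent. *)
Lemma countable_coloring : exists2 n : X -> nat, discrete_mfun n &
  forall i x, Free x -> n (shift (s i) x) <> n x.
Proof.
have [e eP] := enumeration cGamma.
pose w k (x : X) := [seq x (e i) | i <- iota 0 k].
have mw k : discrete_mfun (w k).
  by apply: discrete_mfun_map => i; exact: discrete_mfun_coord.
pose B (v : seq bool) := [set x : X | w (size v) x = v] `&`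
  \bigcap_i ~` [set x : X | w (size v) (shift (s i) x) = v].
have mB v : measurable (B v).
  apply: measurableI; first exact: (mw _ [set v]).
  apply: fin_bigcap_measurable => // i _; apply: measurableC.
  rewrite -[X in measurable X]setTI.
  exact: (measurable_shift cGamma (s i) measurableT (mw _ [set v])).
have BP x : Free x -> exists v, B v x.
  move=> fx; have /choice[g gP] : forall i, exists g, shift (s i) x g <> x g.
    move=> i; apply/existsNP => sx; have /eqP := s_neq1 i; apply.
    by apply: fx; apply/funext.
  (* At the coordinate [g i] the point [x] differs from its [i]-th translate. A window containing
     all the [g i] tells [x] apart from all these translates. *)
  have [k Dk] := window_mkseq [seq g i | i <- enum J] eP.
  exists (w k x); rewrite /B size_map size_iota; split=> // i _ /= wE.
  have /mapP[j jk gE] : g i \in mkseq e k.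
    by apply: Dk; apply: map_f; rewrite mem_enum.
  apply: (gP i); rewrite gE.
  exact: (iffRL (eq_in_map _ _ _) wE j jk).
pose B' j := if unpickle j is Some v then B v else set0.
have mB' j : measurable (B' j) by rewrite /B'; case: unpickle.
have [n mn nP] := discrete_mfun_first mB'.
have B'P x : Free x -> B' (n x) x.
  move=> fx; have [v Bv] := BP x fx; apply: nP; exists (pickle v).
  by rewrite /B' pickleK.
exists n => // i x fx nE.
have := B'P _ fx; have := B'P _ (@Free_invariant _ (s i) _ fx).
rewrite nE /B'; case: unpickle => // v [sxv _] [_ /(_ i I)].
exact.
Qed.

Lemma translation_coloring : exists2 c : X -> 'I_#|J|.+1, discrete_mfun c &
  forall i x, Free x -> c (shift (s i) x) <> c x.
Proof.
have [n mn nP] := countable_coloring.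
apply: (@finite_coloring _ _ _ (fun i => shift (s i)) (@Free Gamma) n) => //.
- by move=> i; exact: measurable_shift.
- by move=> i x; exact: Free_invariant.
- move=> i; have [j jE] := s_inv i; exists j => x.
  by rewrite -actM jE mulVg act1.
Qed.

End translation_coloring.

(** For distinct [g] and [h] in [D], the point [g x] is the translate of [h x] by [g * h^-1], so a
    colouring proper for the translations in [S] separates them. *)
Lemma orbit_coloring (D : seq Gamma) :
  exists m (c : X -> 'I_m), [/\ (size D <= m)%N, discrete_mfun c &
    forall x, Free x -> {in D &, injective (fun g => c (shift g x))}].
Proof.
pose S := [seq s <- [seq (g * h^-1)%g | g <- D, h <- D] | s != 1%g].
have s1 (i : seq_sub S) : val i != 1%g.
  by have := valP i; rewrite mem_filter => /andP[].
have sV (i : seq_sub S) : exists j : seq_sub S, val j = (val i)^-1%g.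
  have := valP i; rewrite mem_filter.
  move=> /andP[i1 /allpairsP[[g h] [/= gD hD iE]]].
  have Vi : (val i)^-1%g \in S.
    rewrite mem_filter invg_eq1 i1; apply/allpairsP; exists (h, g).
    by rewrite /= iE invgM invgK.
  by exists (SeqSub Vi).
have [c mc cP] := translation_coloring s1 sV.
(* The extra colours ensure [size D <= m] even when there is no free point. *)
exists (#|{: seq_sub S}|.+1 + size D)%N, (lshift (size D) \o c).
split; [exact: leq_addl|exact: discrete_mfun_comp|].
move=> x fx g h gD hD /lshift_inj cE.
apply/eqP; apply: contraPT cE => gh.
have ghS : (g * h^-1)%g \in S.
  rewrite mem_filter; apply/andP; split; last by apply/allpairsP; exists (g, h).
  apply: contraNneq gh => /(congr1 (fun u => u * h)%g).
  by rewrite mulgVK mul1g => ->.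
have := cP (SeqSub ghS) _ (@Free_invariant _ h _ fx).
by rewrite -actM mulgVK.
Qed.

End orbit_coloring.

(** * Counting patterns *)

(** The values of [phi] are prescribed on [cs] and free elsewhere, so these maps form a product with
    factors of size 1 on [cs] and 2 off it. *)
Lemma card_pattern_fiber (T : finType) (cs : seq T) (p : seq bool) :
  uniq cs -> size p = size cs ->
  #|[pred phi : {ffun T -> bool} | [seq phi j | j <- cs] == p]| =
    (2 ^ (#|T| - size cs))%N.
Proof.
move=> ucs sp.
pose F j := [pred b | (j \in cs) ==> (b == nth false p (index j cs))].
rewrite (@eq_card _ _ (family F)); last first.
  move=> phi; rewrite !inE; apply/eqP/familyP => [pE j|h].
    rewrite inE; apply/implyP => jcs.
    by rewrite -pE (nth_map j) ?nth_index// index_mem.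
  apply: (@eq_from_nth _ false) => [|i]; rewrite size_map// => ics.
  have /hasP[j0 _ _] : has predT cs by rewrite has_predT (leq_ltn_trans _ ics).
  rewrite (nth_map j0)//.
  have := h (nth j0 cs i); rewrite inE mem_nth// index_uniq//.
  by move=> /eqP.
rewrite card_family foldrE big_image/=.
rewrite (eq_bigr (fun j => if j \in cs then 1 else 2))%N; last first.
  move=> j _; case: ifPn => jcs.
    rewrite -[RHS](card1 (nth false p (index j cs))); apply: eq_card => b.
    by rewrite !inE.
  by rewrite -[RHS]card_bool; apply: eq_card => b; rewrite !inE.
rewrite (bigID (mem cs))/= big1 ?mul1n; last by move=> j ->.
rewrite (eq_bigr (fun=> 2%N)); last by move=> j /negPf ->.
rewrite prod_nat_const; congr expn.
by rewrite -(card_uniqP ucs) -(cardC (mem cs)) addKn; apply: eq_card => j.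
Qed.

Section pattern_count.
Variable Gamma : groupType.
Local Notation X := (Borel (shift_space Gamma)).

Definition patterns (D : seq Gamma) (U : set X) :=
  [pred p : (size D).-tuple bool | `[< U (extend D p) >]].

Lemma extend_inj (D : seq Gamma) (p q : (size D).-tuple bool) : uniq D ->
  {in D, extend D p =1 extend D q} -> p = q.
Proof.
move=> uD pq; apply/val_inj/(@eq_from_nth _ false) => [|i].
  by rewrite !size_tuple.
rewrite size_tuple.
move=> iD; have gD : nth 1%g D i \in D by exact: mem_nth.
by have := pq _ gD; rewrite /extend index_uniq.
Qed.

(** The maps [phi] are sorted by the pattern they induce on [D]. As [c] is injective on [D], every
    pattern comes from equally many maps. *)
Lemma card_recoloring (D : seq Gamma) (U : set X) (T : finType)
    (c : Gamma -> T) : determined D U -> uniq [seq c g | g <- D] ->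
  #|[pred phi : {ffun T -> bool} | `[< U (phi \o c) >]]| =
  (#|patterns D U| * 2 ^ (#|T| - size D))%N.
Proof.
move=> dU ucs.
pose pat (phi : {ffun T -> bool}) : (size D).-tuple bool :=
  [tuple of [seq phi (c g) | g <- in_tuple D]].
rewrite -sum1_card (partition_big pat (patterns D U))/=; last first.
  move=> phi; rewrite !inE => h.
  exact: (iffLR (determined_extend (phi \o c) dU) h).
rewrite -sum_nat_const; apply: eq_bigr => p pU.
have sp : size p = size [seq c g | g <- D] by rewrite size_map size_tuple.
have := card_pattern_fiber ucs sp; rewrite size_map sum1_card => <-.
apply: eq_card => phi; rewrite unfold_in [RHS]unfold_in /=.
rewrite -map_comp.
have -> : (pat phi == p) = ([seq (phi \o c) g | g <- D] == p) by [].
case: eqP => [pE|]; last by rewrite andbF.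
rewrite andbT; apply/asboolT/(iffRL (determined_extend (phi \o c) dU)).
by rewrite pE; exact: asboolW.
Qed.

Context (R : realType) (beta : probability X R).
Hypothesis hbeta : is_bernoulli_measure beta.

Lemma bernoulli_prob_half (b : bool) :
  bernoulli_prob (2^-1 : R) [set b] = (2^-1)%:E.
Proof.
rewrite bernoulli_probE; last by rewrite invr_ge0 ler0n invf_le1 ?ler1n.
have half : (1 - 2^-1 = 2^-1 :> R)%R by rewrite {1}(splitr 1) div1r addrK.
rewrite -[X in _ + X%:E * _]/(1 - 2^-1)%R half !diracE; case: b.
  by rewrite mem_set// memNset// -!EFinM mulr1 mulr0 -EFinD addr0.
by rewrite memNset// mem_set// -!EFinM mulr1 mulr0 -EFinD add0r.
Qed.

Lemma bernoulli_cylinder (D : seq Gamma) (y : X) : uniq D ->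
  beta [set x : X | {in D, x =1 y}] = (2^-1 ^+ size D)%:E.
Proof.
move=> uD; rewrite [LHS](hbeta (fun g => [set y g]) uD).
elim: D {uD} => [|g D IH]; first by rewrite big_nil.
by rewrite big_cons IH bernoulli_prob_half -EFinM -exprS.
Qed.

(** [U] is the disjoint union of the cylinders of its patterns, which all have the same measure. *)
Lemma bernoulli_determined (D : seq Gamma) (U : set X) :
  uniq D -> determined D U ->
  beta U = (#|patterns D U|%:R * 2^-1 ^+ size D)%:E.
Proof.
move=> uD dU.
pose cyl (p : (size D).-tuple bool) := [set x : X | {in D, x =1 extend D p}].
have UE : U = \bigcup_(p in [set` enum (patterns D U)]) cyl p.
  apply/seteqP; split => [x Ux|x [p /=]].
    exists [tuple of [seq x g | g <- in_tuple D]].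
      rewrite /= mem_enum.
      exact/asboolT/(iffLR (determined_extend x dU)).
    by move=> g gD; exact: esym (extend_map x gD).
  rewrite mem_enum => pU xp.
  by apply: (dU (extend D p)); [move=> g gD; rewrite xp|exact: asboolW].
rewrite [X in beta X]UE measure_fin_bigcup//; last 2 first.
- move=> p q _ _ [x [xp xq]]; apply: extend_inj uD _ => g gD.
  by rewrite -xp// xq.
- move=> p _; apply: (determined_measurable (D := D)) => x y xy xp g gD.
  by rewrite -xy// xp.
rewrite -fsbig_seq ?enum_uniq// big_enum/=.
rewrite (eq_bigr (fun=> (2^-1 ^+ size D)%:E)) => [|p _].
  by rewrite sumEFin sumr_const mulr_natl.
exact: bernoulli_cylinder.
Qed.

End pattern_count.

(** * Clopen approximation of independent sets *)

Section bounded_union.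
Context d (T : measurableType d) (R : realType).
Variable mu : {measure set T -> \bar R}.

Lemma measure_bigsetU_le (J : eqType) (s : seq J) (B : J -> set T) (e : R) :
  (forall i, measurable (B i)) ->
  (forall i, i \in s -> mu (B i) <= e%:E) ->
  mu (\big[setU/set0]_(i <- s) B i) <= ((size s)%:R * e)%:E.
Proof.
move=> mB; elim: s => [|i s IH] Be; first by rewrite big_nil measure0 mul0r.
rewrite big_cons; apply: le_trans (measureU2 _ _ _) _ => //.
  exact: bigsetU_measurable.
rewrite -natr1 mulrDl mul1r addrC EFinD; apply: leeD.
  by apply: IH => j sj; apply: Be; rewrite inE sj orbT.
exact/Be/mem_head.
Qed.

End bounded_union.

Section independent_windows.
Variable Gamma : groupType.
Hypothesis cGamma : countable [set: Gamma].
Local Notation X := (Borel (shift_space Gamma)).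
Local Notation shift := (bernoulli_shift Gamma).
Variable R : realType.

(* Approximating in a measure that dominates [beta] and finitely many of its
   translates makes the shift-invariance of [beta] unnecessary. *)
Lemma dominating_translates (mu : {measure set X -> \bar R}) (S : seq Gamma) :
  mu setT < +oo ->
  exists2 nu : {measure set X -> \bar R}, nu setT < +oo &
    forall s (A : set X), s \in S -> mu (shift s @^-1` A) <= nu A.
Proof.
move=> mufin; elim: S => [|g S [nu nufin nuP]]; first by exists mu.
have [tau tauE] : exists tau : {measure set X -> \bar R},
    forall A, tau A = mu (shift g @^-1` A).
  unshelve refine (ex_intro _
    (pushforward mu (shift g) : {measure set X -> \bar R}) _).
    exact: measurable_shift.
  by [].
exists (measure_add tau nu).
  rewrite [ltLHS](measure_addE tau nu setT) tauE preimage_setT.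
  exact: lte_add_pinfty.
move=> s A; rewrite [leRHS](measure_addE tau nu A) inE => /orP[/eqP->|sS].
  by rewrite -tauE leeDl.
by apply: le_trans (nuP _ A sS) _; rewrite leeDr.
Qed.

Lemma independent_window (beta : probability X R) (F : set Gamma) (A : set X)
    (t : R) :
  finite_set F -> measurable A ->
  independent (schreier_graph shift (@Free Gamma) F) A -> t%:E < beta A ->
  exists (D : seq Gamma) (U : set X), [/\ uniq D, determined D U,
    forall x s, (F `|` [set g^-1%g | g in F]) s -> s <> 1%g ->
      U x -> ~ U (shift s x) & t%:E < beta U].
Proof.
move=> finF mA [AF iA] tA.
have /finite_seqP[S FS] : finite_set (F `|` [set g^-1%g | g in F]).
  by rewrite finite_setU; split=> //; exact: finite_image.
(* The identity is added to [S] to control [A] minus [U] as well. *)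
have [nu nufin nuP] : exists2 nu : {measure set X -> \bar R}, nu setT < +oo &
    forall s (A : set X), s \in 1%g :: S -> beta (shift s @^-1` A) <= nu A.
  by apply: dominating_translates; rewrite [ltLHS]probability_setT ltry.
have fA : beta A \is a fin_num by exact: fin_num_measure.
(* With [n] translates, identity included, each losing less than [e], the total loss stays below
   [beta A - t]. *)
pose n := (size S).+1.
pose e := ((fine (beta A) - t) / n%:R)%R.
have e0 : (0 < e)%R.
  by rewrite divr_gt0 ?ltr0n// subr_gt0 -lte_fin fineK.
have [_ /(_ e e0)[D [U [dU nuAU]]]] := measurable_approximable cGamma nufin mA.
pose V := U `&` [set x : X | forall s, s \in S -> s != 1%g -> ~ U (shift s x)].
(* At [g], the point [shift s x] reads the coordinate [g * s] of [x]. *)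
pose E := undup (D ++ [seq (g * s)%g | g <- D, s <- S]).
have dV : determined E V.
  move=> x y xy [Ux Vx]; split.
    by apply: dU Ux => g gD; apply: xy; rewrite mem_undup mem_cat gD.
  move=> s sS s1 Uy; apply: (Vx s sS s1); apply: dU Uy => g gD.
  rewrite /= /shift_fun xy// mem_undup mem_cat; apply/orP; right.
  by apply/allpairsP; exists (g, s).
have mU := determined_measurable dU; have mV := determined_measurable dV.
exists E, V; split => //; first exact: undup_uniq.
  move=> x s Fs s1 [Ux Vx] [Usx _]; apply: (Vx s) => //; last exact/eqP.
  by move: Fs; rewrite FS.
pose B s := shift s @^-1` ((A `\` U) `|` (U `\` A)).
have mB s : measurable (B s).
  rewrite -[X in measurable X]setTI; apply: measurable_shift => //.
  by apply: measurableU; exact: measurableD.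
(* A point of [A] outside [V] either lies outside [U] or has a translate in [U], which is outside
   [A] by independence. So some translate lies in the symmetric difference of [A] and [U]. *)
have AVB : A `\` V `<=` \big[setU/set0]_(s <- 1%g :: S) B s.
  move=> x [Ax nV]; rewrite -bigcup_seq.
  have [Ux|nUx] := pselect (U x); last first.
    exists 1%g; first exact: mem_head.
    by rewrite /B /preimage /mkset act1; left.
  have : ~ forall s, s \in S -> s != 1%g -> ~ U (shift s x).
    by move=> h; apply: nV; split.
  move=> /existsNP[s /not_implyP[sS /not_implyP[s1 /contrapT Usx]]].
  exists s; first by rewrite /= inE sS orbT.
  right; split=> // Asx; apply: (iA x (shift s x)) => //; split.
  - exact: AF.
  - exact: AF.
  - by move=> xE; move/eqP: s1; apply; apply: (AF _ Ax).
  - by exists s => //; rewrite FS.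
have AVe : beta (A `\` V) < beta A - t%:E.
  have Be s : s \in 1%g :: S ->
      beta (B s) <= (fine (nu ((A `\` U) `|` (U `\` A))))%:E.
    move=> sS; rewrite fineK; first exact: nuP.
    by rewrite ge0_fin_numE//; apply: lt_le_trans nuAU _; rewrite leey.
  apply: le_lt_trans (_ : _ <= beta (\big[setU/set0]_(s <- 1%g :: S) B s)) _.
    apply: le_measure; rewrite ?inE//; first exact: measurableD.
    exact: bigsetU_measurable.
  apply: le_lt_trans (measure_bigsetU_le mB Be) _.
  have -> : beta A - t%:E = (n%:R * e)%:E.
    by rewrite -{1}(fineK fA) -EFinB mulrC divfK// pnatr_eq0.
  rewrite lte_fin ltr_pM2l ?ltr0n// -lte_fin fineK//.
  by rewrite ge0_fin_numE//; apply: lt_le_trans nuAU _; rewrite leey.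
have : beta A <= beta (A `\` V) + beta V.
  apply: le_trans (measureU2 _ _ _) => //; last exact: measurableD.
  apply: le_measure; rewrite ?inE//.
    by apply: measurableU => //; exact: measurableD.
  by move=> x Ax; have [Vx|nVx] := pselect (V x); [right|left].
rewrite -(fineK fA) -(fineK (fin_num_measure beta V mV)).
rewrite -(fineK (fin_num_measure beta _ (measurableD mA mV))) in AVe *.
rewrite -(fineK fA) -EFinB -EFinD !(lee_fin, lte_fin) in AVe *.
move=> le; rewrite -ltrBlDl in AVe *; lra.
Qed.
End independent_windows.

(** * The fractional chromatic number *)

Section fractional_bound.
Variable Gamma : groupType.
Hypothesis cGamma : countable [set: Gamma].
Local Notation X := (Borel (shift_space Gamma)).
Local Notation shift := (bernoulli_shift Gamma).
Variable R : realType.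

Lemma borel_fractional_le (G : graph X) (k l : nat) (I : 'I_l -> set X) :
  (1 <= k)%N -> (forall i, measurable (I i) /\ independent G (I i)) ->
  (forall x, vertices G x -> (k <= #|[pred i | x \in I i]|)%N) ->
  borel_fractional_chromatic R G <= (l%:R / k%:R)%:E.
Proof.
move=> k1 I_ind I_cov.
apply: (@le_trans _ _ (borel_kfold_chromatic R G k * (k%:R^-1)%:E)).
  by apply: ereal_inf_lbound; exists k.
rewrite EFinM; apply: lee_wpmul2r; first by rewrite lee_fin invr_ge0.
by apply: ereal_inf_lbound; exists l => //; exists I.
Qed.

Lemma window_fractional_bound (beta : probability X R) (F : set Gamma)
    (D : seq Gamma) (U : set X) (t : R) :
  is_bernoulli_measure beta -> uniq D -> determined D U ->
  (forall x s, (F `|` [set g^-1%g | g in F]) s -> s <> 1%g ->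
    U x -> ~ U (shift s x)) ->
  (0 < t)%R -> t%:E < beta U ->
  borel_fractional_chromatic R (schreier_graph shift (@Free Gamma) F) <=
    (t^-1)%:E.
Proof.
move=> hbeta uD dU iU t0 tU.
have [m [c [Dm mc cP]]] := orbit_coloring cGamma D.
pose Phi := {ffun 'I_m -> bool}.
pose f (phi : Phi) (x : X) : X := fun g => phi (c (shift g x)).
have fE (phi : Phi) s x : f phi (shift s x) = shift s (f phi x).
  by apply/funext => g; rewrite /f -actM.
pose q := #|patterns D U|.
pose k := (q * 2 ^ (m - size D))%N.
have kE x : Free x -> #|[pred phi : Phi | `[< U (f phi x) >]]| = k.
  move=> fx; rewrite /k -[m in RHS]card_ord.
  apply: (@card_recoloring _ D U _ (fun g => c (shift g x))) => //.
  by rewrite map_inj_in_uniq//; exact: cP.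
have UE : beta U = (q%:R / 2 ^+ size D)%:E.
  by rewrite (bernoulli_determined hbeta uD dU) exprVn.
(* Positivity of [t] forces [U] to have a pattern, so that [k] is at least 1. *)
have q0 : (0 < q)%N.
  rewrite lt0n; apply/eqP => q0; move: tU; rewrite UE q0 mul0r lte_fin.
  by rewrite ltNge (ltW t0).
have k0 : (0 < k)%N by rewrite muln_gt0 q0 expn_gt0.
pose I (i : 'I_#|{: Phi}|) := @Free Gamma `&` (f (enum_val i) @^-1` U).
apply: (le_trans (borel_fractional_le (I := I) k0 _ _)).
- move=> i; split.
    apply: measurableI; first exact: measurable_Free.
    apply: measurable_preimage_determined dU => g.
    apply: (discrete_mfun_comp (enum_val i : Phi)).
    by apply: discrete_mfun_precomp mc; exact: measurable_shift.
  split=> [x []//|x y [_ Ux] [_ Uy] [_ _ xy [s Fs ys]]].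
  have s1 : s <> 1%g by move=> s1; apply: xy; rewrite ys s1 act1.
  (* By equivariance the images of [x] and [y] also differ by [s]. These images need not be free, so
     [iU] is used at an arbitrary point. *)
  by apply: (iU _ s Fs s1 Ux); rewrite -fE -ys.
- move=> x fx; rewrite -(kE x fx) -!sum1_card big_mkcond big_enum_val/=.
  rewrite [leqRHS]big_mkcond/=; apply: leq_sum => i _.
  case: ifP => // /asboolW Ufx; rewrite ifT//; exact/mem_set.
(* There are [2 ^ m] sets covering [q * 2 ^ (m - size D)] times; the ratio is [2 ^ size D / q], the
   inverse of [beta U]. *)
- rewrite lee_fin card_ffun card_bool card_ord -[in X in (2 ^ X)%N](subnKC Dm).
  rewrite expnD /k !natrM -mulf_div divff ?mulr1 ?pnatr_eq0 ?expn_eq0//.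
  rewrite UE lte_fin in tU; rewrite -[leLHS]invf_div natrX lef_pV2 ?ltW//.
    by rewrite posrE (lt_trans t0).
Qed.
End fractional_bound.

(** * Full measure of the free part of an infinite group's shift *)

Section full_measure.
Variable Gamma : groupType.
Hypothesis cGamma : countable [set: Gamma].
Local Notation X := (Borel (shift_space Gamma)).
Local Notation shift := (bernoulli_shift Gamma).
Variables (R : realType) (beta : probability X R).
Hypothesis hbeta : is_bernoulli_measure beta.
Hypothesis infGamma : infinite_set [set: Gamma].

Lemma disjoint_translates (g : Gamma) n : g <> 1%g ->
  exists2 L : seq Gamma, size L = n & uniq (L ++ [seq (h * g)%g | h <- L]).
Proof.
move=> /eqP g1; elim: n => [|n [L sL uL]]; first by exists [::].
(* The next element [h] must avoid [L] and [L g], and [h * g] must avoid [L]; this excludes finitely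
   many elements of an infinite group. *)
pose M := L ++ [seq (h * g)%g | h <- L] ++ [seq (h * g^-1)%g | h <- L].
have [h _ hM] : exists2 h : Gamma, [set: Gamma] h & h \notin M.
  apply: contrapT => /forall2NP nM; apply: infGamma.
  apply: (sub_finite_set _ (finite_seq M)) => h _ /=.
  by have [/(_ Logic.I)|/negP/negPn] := nM h.
move: hM; rewrite !mem_cat !negb_or => /and3P[hL hLg hLV].
exists (h :: L); rewrite /= ?sL//.
have hgh : (h * g)%g != h.
  apply: contra_neq g1 => /(congr1 (fun u => h^-1 * u)%g).
  by rewrite mulKg mulVg.
have hgL : (h * g)%g \notin L.
  apply: contra hLV => hgL; apply/mapP; exists (h * g)%g => //.
  by rewrite mulgK.
have hgLg : (h * g)%g \notin [seq (h * g)%g | h <- L].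
  by apply: contra hL => /mapP[u Lu /mulIg->].
rewrite mem_cat inE (negPf hL) eq_sym (negPf hgh) (negPf hLg)/=.
rewrite (perm_uniq (permEl (perm_catCA L [:: (h * g)%g] _)))/=.
by rewrite mem_cat (negPf hgL) (negPf hgLg).
Qed.

Lemma stabilized_measurable (g : Gamma) :
  measurable [set x : X | shift g x = x].
Proof.
have [e eP] := enumeration cGamma.
have -> : [set x : X | shift g x = x] =
    \bigcap_n [set x : X | x (e n * g)%g = x (e n)].
  apply/seteqP; split => [x /= gx n _ /=|x h /=].
    by rewrite -[in RHS]gx.
  by apply/funext => u; have [n <-] := eP u; exact: h.
apply: bigcapT_measurable => n.
apply: (@determined_measurable _ [:: (e n * g)%g; e n]) => x y xy.
by rewrite /mkset !xy ?inE ?eqxx ?orbT.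
Qed.

(** A fixed point repeats on [L g] its values on [L]. Its pattern on these [2 n] coordinates is thus
    determined by [n] of them, leaving at most [2 ^ n] patterns out of [2 ^ (2 n)]. *)
Lemma stabilized_le (g : Gamma) n : g <> 1%g ->
  beta [set x : X | shift g x = x] <= (2^-1 ^+ n)%:E.
Proof.
move=> g1; have [L sL uD] := disjoint_translates n g1.
pose Lg := [seq (h * g)%g | h <- L].
pose C := [set x : X | forall h, h \in L -> x (h * g)%g = x h].
have dC : determined (L ++ Lg) C.
  move=> x y xy Cx h hL; rewrite -!xy ?mem_cat ?hL//; first exact: Cx.
  by apply/orP; right; apply/mapP; exists h.
have mC := determined_measurable dC.
apply: (@le_trans _ _ (beta C)).
  apply: le_measure; rewrite ?inE//; first exact: stabilized_measurable.
  by move=> x /= gx h _; rewrite -[in RHS]gx.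
rewrite (bernoulli_determined hbeta uD dC) lee_fin.
set q := #|patterns _ _|; rewrite size_cat size_map sL exprD.
rewrite mulrA ler_piMl ?exprn_ge0 ?invr_ge0// exprVn ler_pdivrMr ?exprn_gt0//.
rewrite mul1r -natrX ler_nat {}/q.
pose res (p : (size (L ++ Lg)).-tuple bool) : (size L).-tuple bool :=
  [tuple of [seq extend (L ++ Lg) p h | h <- in_tuple L]].
have res_inj : {in patterns (L ++ Lg) C &, injective res}.
  move=> p q /asboolW Cp /asboolW Cq /(congr1 val)/= pq.
  have pqL : {in L, extend (L ++ Lg) p =1 extend (L ++ Lg) q}.
    exact: (iffRL (eq_in_map _ _ _) pq).
  apply: extend_inj uD _ => h; rewrite mem_cat => /orP[/pqL//|/mapP[h' h'L ->]].
  by rewrite (Cp _ h'L) (Cq _ h'L) pqL.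
rewrite -(card_in_imset res_inj) (leq_trans (max_card _))//.
by rewrite card_tuple card_bool sL.
Qed.

Lemma stabilized_null (g : Gamma) : g <> 1%g ->
  beta.-negligible [set x : X | shift g x = x].
Proof.
move=> g1; have mZ := stabilized_measurable g.
apply/(iffRL (negligibleP _ mZ))/eqP; rewrite eq_le measure_ge0 andbT.
rewrite -(fineK (fin_num_measure beta _ mZ)) lee_fin leNgt; apply/negP => b0.
set b := fine _ in b0; pose n := Num.bound b^-1.
have : (b <= 2^-1 ^+ n)%R.
  by rewrite -lee_fin fineK ?fin_num_measure//; exact: stabilized_le.
apply/negP; rewrite -ltNge exprVn invf_plt ?posrE ?exprn_gt0//.
apply: lt_trans (archi_boundP _) _; first by rewrite invr_ge0 ltW.
by rewrite -natrX ltr_nat ltn_expl.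
Qed.

(** A non-free point is fixed by one of countably many nontrivial elements, each fixing only a null
    set. *)
Lemma Free_full : beta (@Free Gamma) = 1.
Proof.
have mFree := measurable_Free cGamma.
have : beta.-negligible (~` @Free Gamma).
  have [e eP] := enumeration cGamma.
  apply: (@negligibleS _ _ _ _ (\bigcup_n
    (if e n == 1%g then set0 else [set x | shift (e n) x = x]))).
    move=> x /existsNP[g /not_implyP[gx /eqP g1]]; have [n en] := eP g.
    by exists n => //; rewrite en (negPf g1).
  apply: negligible_bigcup => n; case: eqP => [_|en].
    exact: negligible_set0.
  exact: stabilized_null.
move=> /(iffLR (negligibleP _ (measurableC mFree))) C0.
have : beta (@Free Gamma) + beta (~` @Free Gamma) = 1.
  rewrite -measureU ?setICr ?setUCr//; last exact: measurableC.
  exact: probability_setT.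
by rewrite C0 adde0.
Qed.

End full_measure.

(** * Finite groups and the comparison of the chromatic numbers *)

Section finite_group.
Variable Gamma : groupType.
Hypothesis finGamma : finite_set [set: Gamma].
Local Notation X := (Borel (shift_space Gamma)).

Lemma finite_measurable (A : set X) : measurable A.
Proof.
have /finite_seqP[s sE] := finGamma.
apply: (@determined_measurable _ s) => x y xy.
suff -> : x = y by [].
by apply/funext => g; apply: xy; have : [set: Gamma] g by []; rewrite sE.
Qed.

End finite_group.

Theorem corollary1p2 (R : realType) (Gamma : groupType)
    (cGamma : countable [set: Gamma])
    (beta : probability (Borel (shift_space Gamma)) R)
    (hbeta : is_bernoulli_measure beta)
    (F : set Gamma) (finF : finite_set F) :
  let G := schreier_graph (bernoulli_shift Gamma) (@Free Gamma) F in
  borel_fractional_chromatic R G <=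
  measure_chromatic (mrestr beta (measurable_Free cGamma)) G.
Proof.
pose X := Borel (shift_space Gamma).
cbv zeta; set G := schreier_graph _ _ _.
apply: le_ereal_inf_tmp => _ [l [I [I_ind I_cov]] <-].
(* For finite [Gamma] the given sets are already Borel and form a 1-fold cover. Full measure of the
   free part is available only in the infinite case. *)
have [finGamma|infGamma] := pselect (finite_set [set: Gamma]).
  rewrite -[l%:R]divr1.
  apply: (borel_fractional_le R (k := 1%N) (I := I)) => // [i|x].
    by split; [exact: finite_measurable|case: (I_ind i)].
  rewrite -I_cov => -[i _ Ix]; apply/card_gt0P; exists i.
  exact/mem_set.
have mFree := measurable_Free cGamma.
(* Each [I i] is squeezed between Borel sets of equal measure: the outer ones cover the free part,
   the inner ones inherit independence. *)
have /choice[AC ACP] : forall i, exists AC : set X * set X,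
    [/\ measurable AC.1, AC.1 `<=` I i, measurable AC.2, I i `<=` AC.2 &
        beta AC.2 <= beta AC.1].
  move=> i; have [[A mA [N [B [mB B0 NB]] ANE]] [If _]] := I_ind i.
  (* [B] is null for the restricted measure, so only its free part is [beta]-null. This suffices
     because [I i] lies in the free part. *)
  have mBf : measurable (B `&` @Free Gamma) by exact: measurableI.
  exists (A, A `|` (B `&` @Free Gamma)); split => //=.
  - by rewrite -ANE; exact: subsetUl.
  - exact: measurableU.
  - move=> x Ix; move: (Ix); rewrite -ANE => -[Ax|/NB Bx]; first by left.
    by right; split=> //; exact: If.
  - apply: le_trans (measureU2 _ mA mBf) _.
    by rewrite [X in _ + X](_ : _ = 0) ?adde0.
apply/lee_addgt0Pr => e e0.
(* The inverse of [t] is exactly the target [l + e], and [l * t < 1] leaves room for the pigeonhole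
   below. *)
pose t := ((l%:R + e)^-1 : R)%R.
have le0 : (0 < l%:R + e :> R)%R by rewrite ltr_wpDl.
have t0 : (0 < t)%R by rewrite invr_gt0.
(* Otherwise the outer sets would cover the free part, of measure 1, with total measure at most
   [l * t]. *)
have [i ti] : exists i, t%:E < beta (AC i).1.
  apply: contrapT => /forallNP small.
  have mC i : measurable (AC i).2 by case: (ACP i).
  have Ct i : i \in enum 'I_l -> beta (AC i).2 <= t%:E.
    move=> _; have [_ _ _ _ CA] := ACP i; apply: le_trans CA _.
    by rewrite leNgt; apply/negP/small.
  have : beta (@Free Gamma) <= (l%:R * t)%:E.
    rewrite -[l in leRHS]size_enum_ord.
    apply: le_trans (measure_bigsetU_le mC Ct).
    apply: le_measure; rewrite ?inE//; first exact: bigsetU_measurable.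
    move=> x fx; have [i _ Ix] : (\bigcup_i I i) x by rewrite I_cov.
    rewrite -bigcup_seq; exists i; first by rewrite /= mem_enum.
    by have [_ _ _ IC _] := ACP i; exact: IC.
  rewrite Free_full// lee_fin leNgt => /negP; apply.
  by rewrite ltr_pdivrMr// mul1r ltrDl.
have mA : measurable (AC i).1 by case: (ACP i).
have indA : independent G (AC i).1.
  have [_ [IF Iind]] := I_ind i; have [_ AI _ _ _] := ACP i.
  by split=> [x /AI/IF//|x y /AI Ix /AI Iy]; exact: Iind.
have [D [U [uD dU iU tU]]] := independent_window cGamma finF mA indA ti.
have := window_fractional_bound cGamma hbeta uD dU iU t0 tU.
by rewrite invrK EFinD.
Qed.
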